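(* Let $k\ge1$ and let $S_k$ be the star graph on $k+1$ vertices, with associated simply connected 2-step nilpotent Lie group $N_{S_k}$ equipped with its standard left-invariant metric. For $p=\exp(W)\in N_{S_k}$, $Y\in\mathfrak n_{S_k}$ and $j=1,\dots,k$ let $$f_{V_j^*}(p,Y)=\langle V_j-\langle W,V_0\rangle Z_j,\,Y\rangle,\qquad f_{Z_j}(p,Y)=\langle Z_j,Y\rangle,\qquad E(p,Y)=\tfrac12\langle Y,Y\rangle .$$ Then the smooth functions $f_{V_j^*}$, $j=1,\dots,k$, on $TN_{S_k}$ are pairwise in involution. Moreover, the geodesic flow on $TN_{S_k}$ is completely integrable (in the sense of Liouville): the functions in the set $\{E,f_{Z_j},f_{V_j^*}\}_{j=1}^k$ are first integrals, any pair of them is in involution, and the corresponding gradients are linearly independent on an open dense set.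
   Context: The Lie algebra $\mathfrak n_{S_k}$ of $N_{S_k}$ is the real Lie algebra with basis $V_0,V_1,\dots,V_k,Z_1,\dots,Z_k$ and nonzero brackets $[V_0,V_i]=Z_i=-[V_i,V_0]$ ($1\le i\le k$). The standard metric $\langle\,,\rangle$ is the left-invariant metric making this basis orthonormal. The map $\exp:\mathfrak n_{S_k}\to N_{S_k}$ is a diffeomorphism. $TN_{S_k}\simeq N_{S_k}\times\mathfrak n_{S_k}$ by sending $v_p$ to $(p,Y)$, with $Y$ the left-invariant vector field such that $Y(p)=v_p$. For a Riemannian manifold $M$ of dimension $n$, $TM$ carries the symplectic form obtained from the canonical one on $T^*M$ via the metric, with Poisson bracket $\{\,,\}$. Functions $f,g$ are in involution if $\{f,g\}=0$. A smooth $f:TM\to\mathbb R$ is a first integral of the geodesic flow if $\{f,E\}=0$, where $E(v)=\tfrac12\langle v,v\rangle$. The geodesic flow is completely integrable (in the sense of Liouville) if there are $n$ first integrals $f_1,\dots,f_n:TM\to\mathbb R$ with $\{f_i,f_j\}=0$ for all $i,j$ and with gradients linearly independent on an open dense subset of $TM$. *)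

(* Defs.v *)
From HB Require Import structures.
From mathcomp Require Import all_boot all_order all_algebra.
From mathcomp Require Import all_classical all_reals all_analysis.

Set Implicit Arguments.
Unset Strict Implicit.
Unset Printing Implicit Defensive.

Import Order.TTheory GRing.Theory Num.Theory.
Import numFieldNormedType.Exports.

Local Open Scope classical_set_scope.
Local Open Scope ring_scope.

(** ** Smooth functions *)

(** C^oo : every iterated directional derivative is differentiable everywhere. *)

Fixpoint iter_derive (R : realType) (V : normedModType R) (s : seq V)
    (f : V -> R) : V -> R :=
  if s is v :: s' then 'D_v (iter_derive s' f) else f.

Definition smooth (R : realType) (V : normedModType R) (f : V -> R) : Prop :=
  forall (s : seq V) (x : V), differentiable (iter_derive s f) x.

(** ** Geodesic flow of a Riemannian manifold with a global chart

    The manifold M is identified with R^n through a global chart.  A point of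
    TM is a pair (p, v), v being the coordinates of the tangent vector in the
    chart, and g p u v is the metric at p. *)

Notation TM R n := ('rV[R]_n * 'rV[R]_n)%type.

Notation metric_on R n := ('rV[R]_n -> 'rV[R]_n -> 'rV[R]_n -> R).

(** The canonical 1-form of T^*M maps a vector A at the covector xi to
    xi (dpi A); here it is pulled back by the map v |-> g(v, _), TM -> T^*M. *)
Definition canonical_1form (R : realType) (n : nat) (g : metric_on R n)
    (x A : TM R n) : R :=
  g x.1 x.2 A.1.

(** omega = - d theta, where
    d theta (A, B) = A (theta B) - B (theta A) - theta [A, B]
    is evaluated on constant (hence commuting) vector fields A and B. *)
Definition symplectic_form (R : realType) (n : nat) (g : metric_on R n)
    (x A B : TM R n) : R :=
  - ('D_A (fun y : TM R n => canonical_1form g y B) x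
     - 'D_B (fun y : TM R n => canonical_1form g y A) x).

(** The vector X_f(x) such that omega_x (X_f(x), _) = df_x.  It exists and is
    unique since omega is nondegenerate; 0 is only a default for xget. *)
Definition hamiltonian_field (R : realType) (n : nat) (g : metric_on R n)
    (f : TM R n -> R) (x : TM R n) : TM R n :=
  xget 0 [set A | forall B, symplectic_form g x A B = 'd f x B].

Definition poisson (R : realType) (n : nat) (g : metric_on R n)
    (f h : TM R n -> R) (x : TM R n) : R :=
  symplectic_form g x (hamiltonian_field g f x) (hamiltonian_field g h x).

Definition in_involution (R : realType) (n : nat) (g : metric_on R n)
    (f h : TM R n -> R) : Prop :=
  forall x, poisson g f h x = 0.

Definition energy (R : realType) (n : nat) (g : metric_on R n)
    (x : TM R n) : R :=
  2^-1 * g x.1 x.2 x.2.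

Definition first_integral (R : realType) (n : nat) (g : metric_on R n)
    (f : TM R n -> R) : Prop :=
  smooth f /\ in_involution g f (energy g).

(** The gradient in the coordinates (p, v) of TM.  Gradients with respect to
    two Riemannian metrics on TM differ pointwise by a linear automorphism of
    the tangent space that does not depend on the function, so that linear
    independence of gradients does not depend on the metric chosen on TM. *)
Definition gradient (R : realType) (n : nat) (f : TM R n -> R) (x : TM R n) :
    TM R n :=
  (\row_i 'D_(delta_mx 0 i, 0) f x, \row_i 'D_(0, delta_mx 0 i) f x).

Definition independent_at (R : realType) (n m : nat) (F : 'I_m -> TM R n -> R)
    (x : TM R n) : Prop :=
  free [seq gradient (F i) x | i : 'I_m].

Definition liouville_system (R : realType) (n : nat) (g : metric_on R n)
    (F : 'I_n -> TM R n -> R) : Prop :=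
  [/\ forall i, first_integral g (F i),
      forall i j, in_involution g (F i) (F j)
    & exists U : set (TM R n),
        [/\ open U, dense U & forall x, U x -> independent_at F x]].

Definition completely_integrable (R : realType) (n : nat) (g : metric_on R n) :
    Prop :=
  exists F : 'I_n -> TM R n -> R, liouville_system g F.

(** ** The Lie algebra of the star graph

    Coordinates with respect to the basis V_0, ..., V_k, Z_1, ..., Z_k; the
    index j : 'I_k stands for j + 1 in V_{j+1} and Z_{j+1}. *)

Notation star_dim k := (k.+1 + k)%N.

Notation star_alg R k := 'rV[R]_(star_dim k).

Definition basisV (R : realType) (k : nat) (i : 'I_k.+1) : star_alg R k :=
  delta_mx 0 (lshift k i).

Definition basisZ (R : realType) (k : nat) (j : 'I_k) : star_alg R k :=
  delta_mx 0 (rshift k.+1 j).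

Definition V0 (R : realType) (k : nat) : star_alg R k := basisV R ord0.

Definition Vj (R : realType) (k : nat) (j : 'I_k) : star_alg R k :=
  basisV R (lift ord0 j).

Definition dot (R : realType) (k : nat) (X Y : star_alg R k) : R :=
  \sum_i X 0 i * Y 0 i.

Definition bracket (R : realType) (k : nat) (X Y : star_alg R k) : star_alg R k :=
  \sum_(j < k) (dot X (V0 R k) * dot Y (Vj R j)
                - dot Y (V0 R k) * dot X (Vj R j)) *: basisZ R j.

(** ** The group N_{S_k}

    Its global chart is exp^{-1} : the vector W stands for exp W.  By the
    Baker-Campbell-Hausdorff formula in step 2,
    exp W exp W' = exp (W + W' + [W, W'] / 2). *)

Definition star_mul (R : realType) (k : nat) (W W' : star_alg R k) :
    star_alg R k :=
  W + W' + 2^-1 *: bracket W W'.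

Definition star_inv (R : realType) (k : nat) (W : star_alg R k) : star_alg R k :=
  - W.

(** TN -> N * n.  The left-invariant field Y with Y(p) = v is
    Y = d(L_{p^-1})_p v. *)
Definition left_triv (R : realType) (k : nat) (x : TM R (star_dim k)) :
    star_alg R k * star_alg R k :=
  (x.1, 'D_(x.2) (star_mul (star_inv x.1)) x.1).

Definition star_metric (R : realType) (k : nat) : metric_on R (star_dim k) :=
  fun p u v => dot (left_triv (p, u)).2 (left_triv (p, v)).2.

(** Functions on N * n, in the variables (W, Y) with p = exp W. *)

Definition fE (R : realType) (k : nat) (q : star_alg R k * star_alg R k) : R :=
  2^-1 * dot q.2 q.2.

Definition fZ (R : realType) (k : nat) (j : 'I_k)
    (q : star_alg R k * star_alg R k) : R :=
  dot (basisZ R j) q.2.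

Definition fV (R : realType) (k : nat) (j : 'I_k)
    (q : star_alg R k * star_alg R k) : R :=
  dot (Vj R j - dot q.1 (V0 R k) *: basisZ R j) q.2.

(** The 2k + 1 functions E, f_{Z_1}, ..., f_{Z_k}, f_{V_1^*}, ..., f_{V_k^*}
    on TN. *)
Definition star_family (R : realType) (k : nat) (i : 'I_(star_dim k)) :
    TM R (star_dim k) -> R :=
  match fintype.split i with
  | inl a => if unlift ord0 a is Some j then fZ j \o @left_triv R k
             else @fE R k \o @left_triv R k
  | inr j => fV j \o @left_triv R k
  end.

(* Main.v *)
Require Import Defs.
From HB Require Import structures.
From mathcomp Require Import all_boot all_order all_algebra.
From mathcomp Require Import all_classical all_reals all_analysis.
From mathcomp Require Import ring.

Set Implicit Arguments.
Unset Strict Implicit.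
Unset Printing Implicit Defensive.

Import Order.TTheory GRing.Theory Num.Theory.
Import numFieldNormedType.Exports.

Local Open Scope classical_set_scope.
Local Open Scope ring_scope.

(** Write x = (p, v), Y = v - [p, v] / 2 for the left trivialization of v, and,
    for a tangent vector A = (A1, A2) at x, let a and a' be the left-invariant
    velocity of A1 and the derivative of Y along A.  In this frame
      omega (A, B) = <a, b'> - <a', b> + <Y, [a, b]>,
    so that the Hamiltonian fields are explicit: (a, a') is
      (Z_j, 0) for f_{Z_j},  (V_j - p_0 Z_j, 0) for f_{V_j^*},
      (Y, ad_Y^T Y) for E.
    All Poisson brackets are then immediate.  Along the fibres, the differentials
    are the pairings with Y, Z_j and V_j - p_0 Z_j, which are independent as soon
    as the V_0-component of Y, equal to that of v, is nonzero. *)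

(** * Smoothness of polynomial functions *)

Lemma linear_is_diff (R : realType) (V W : normedModType R) (f : V -> W)
    (x : V) :
  linear f -> continuous f -> is_diff x f f.
Proof.
move=> lf cf; pose fM := GRing.isLinear.Build _ _ _ _ _ lf.
pose fL : {linear _ -> _} := HB.pack f fM.
apply: DiffDef; first exact: (@linear_differentiable _ _ _ fL).
exact: (@diff_lin _ _ _ fL).
Qed.

Lemma linear_is_derive (R : realType) (V W : normedModType R) (f : V -> W)
    (x v : V) :
  linear f -> continuous f -> is_derive x v f (f v).
Proof.
move=> lf cf; have [dx fE] := linear_is_diff x lf cf.
by apply: DeriveDef; [exact: diff_derivable|rewrite deriveE // fE].
Qed.

Section Polyfun.
Context {R : realType} {V : normedModType R}.
Implicit Types f g : V -> R.

(** The class is stable under ['D_v], so smoothness, which involves all iterated derivatives,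
    reduces to one differentiability statement. Generators are continuous linear forms, since [V] is
    an arbitrary normed module. *)
Inductive polyfun : (V -> R) -> Prop :=
| polyfun_cst c : polyfun (fun=> c)
| polyfun_lin f : linear f -> continuous f -> polyfun f
| polyfunD f g : polyfun f -> polyfun g -> polyfun (fun x => f x + g x)
| polyfunM f g : polyfun f -> polyfun g -> polyfun (fun x => f x * g x).

Lemma polyfun_sum n (F : 'I_n -> V -> R) :
  (forall i, polyfun (F i)) -> polyfun (fun x => \sum_i F i x).
Proof.
elim: n F => [|n IH] F pF.
  rewrite (_ : (fun x => _) = fun=> 0); first exact: polyfun_cst.
  by apply/funext => x; rewrite big_ord0.
rewrite (_ : (fun x => _) = fun x => F ord0 x + \sum_i F (lift ord0 i) x).
  by apply: polyfunD => //; exact: IH.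
by apply/funext => x; rewrite big_ord_recl.
Qed.

Lemma polyfun_differentiable f : polyfun f -> forall x, differentiable f x.
Proof.
elim=> [c x|{}f lf cf x|{}f g _ df _ dg x|{}f g _ df _ dg x].
- exact: differentiable_cst.
- by case: (linear_is_diff x lf cf).
- exact: differentiableD.
- exact: differentiableM.
Qed.

(** By induction on the construction: a linear form has a constant derivative, and a product is
    handled by the Leibniz rule. *)
Lemma polyfun_derive v f : polyfun f -> polyfun ('D_v f).
Proof.
elim=> [c|{}f lf cf|{}f g pf Df pg Dg|{}f g pf Df pg Dg].
- rewrite (_ : 'D_v _ = fun=> 0); first exact: polyfun_cst.
  by apply/funext => x; rewrite derive_cst.
- rewrite (_ : 'D_v _ = fun=> f v); first exact: polyfun_cst.
  apply/funext => x; case: (linear_is_diff x lf cf) => dx fE.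
  by rewrite deriveE // fE.
- rewrite (_ : 'D_v _ = fun x => 'D_v f x + 'D_v g x); first exact: polyfunD.
  apply/funext => x; have dfx := polyfun_differentiable pf x.
  have dgx := polyfun_differentiable pg x.
  by rewrite deriveD //; exact: diff_derivable.
- rewrite (_ : 'D_v _ = fun x => f x * 'D_v g x + g x * 'D_v f x).
    by apply: polyfunD; exact: polyfunM.
  apply/funext => x; have dfx := polyfun_differentiable pf x.
  have dgx := polyfun_differentiable pg x.
  by rewrite deriveM //; exact: diff_derivable.
Qed.

Lemma polyfun_smooth f : polyfun f -> smooth f.
Proof.
move=> pf s; suff : polyfun (iter_derive s f) by exact: polyfun_differentiable.
by elim: s => //= v s; exact: polyfun_derive.
Qed.

End Polyfun.

(** * Poisson brackets and linear independence of gradients *)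

Section Poisson.
Context {R : realType} {n : nat} (g : metric_on R n).
Implicit Types (f h : TM R n -> R) (x A B : TM R n).

Lemma symplectic_formC x A B :
  symplectic_form g x A B = - symplectic_form g x B A.
Proof. by rewrite /symplectic_form opprK opprB. Qed.

Lemma in_involutionC f h : in_involution g f h -> in_involution g h f.
Proof. by move=> fh x; rewrite /poisson symplectic_formC [X in - X]fh oppr0. Qed.

(** The defining equation at one point, so that an explicit candidate can be checked without proving
    nondegeneracy of the form. *)
Definition hamiltonian_at f x A := forall B, symplectic_form g x A B = 'd f x B.

(** Once some solution is known, [xget] returns a solution rather than its default 0, though
    possibly a different one. *)
Lemma hamiltonian_fieldP f x A : hamiltonian_at f x A ->
  hamiltonian_at f x (hamiltonian_field g f x).
Proof. by move=> fA; rewrite /hamiltonian_field; case: xgetP => // /(_ A)[]. Qed.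

(* Antisymmetry of the form replaces the uniqueness of Hamiltonian vectors. *)
Lemma poissonE f h x A A' : hamiltonian_at f x A -> hamiltonian_at h x A' ->
  poisson g f h x = 'd f x A'.
Proof.
move=> fA hA'; rewrite /poisson (hamiltonian_fieldP fA) -fA symplectic_formC.
by rewrite (hamiltonian_fieldP hA') -hA' -symplectic_formC fA.
Qed.
End Poisson.

(** * Coordinate functions on the tangent bundle *)

Section Coordinates.
Context {R : realType} {n : nat}.

Lemma linear_fst_coord i : linear (fun y : TM R n => y.1 0 i).
Proof. by move=> a u v /=; rewrite !mxE. Qed.

Lemma linear_snd_coord i : linear (fun y : TM R n => y.2 0 i).
Proof. by move=> a u v /=; rewrite !mxE. Qed.

Lemma continuous_fst_coord i : continuous (fun y : TM R n => y.1 0 i).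
Proof.
move=> x; apply: (@continuous_comp _ _ _ fst (fun M : 'rV[R]_n => M 0 i)).
  exact: cvg_fst.
exact: coord_continuous.
Qed.

Lemma continuous_snd_coord i : continuous (fun y : TM R n => y.2 0 i).
Proof.
move=> x; apply: (@continuous_comp _ _ _ snd (fun M : 'rV[R]_n => M 0 i)).
  exact: cvg_snd.
exact: coord_continuous.
Qed.

End Coordinates.

Section Independence.
Context {R : realType} {n m : nat}.
Implicit Types (F : 'I_m -> TM R n -> R) (x : TM R n) (c : 'I_m -> R).

Lemma independent_atP F x :
  (forall c, \sum_i c i *: gradient (F i) x = 0 -> forall i, c i = 0) ->
  independent_at F x.
Proof.
move=> cF; apply: (introT (@freeP _ _ _ (codom_tuple (fun i => gradient (F i) x)))).
(* [free] counts along the enumeration of ['I_m]; coefficients are carried over by [enum_rank] and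
   [enum_val]. *)
move=> c c0 i; rewrite -[i]enum_valK; apply: (cF (c \o enum_rank)).
rewrite -[RHS]c0 (reindex (@enum_val _ 'I_m)) /=; last first.
  by exists enum_rank => j _; rewrite ?enum_valK ?enum_rankK.
by apply: eq_bigr => j _; rewrite enum_valK nth_codom.
Qed.

(** The second half of a gradient represents the differential on vertical vectors [(0, b)]. A
    relation between gradients therefore gives the same relation between differentials along the
    fibre. *)
Lemma independent_at_fibre F x :
  (forall i, differentiable (F i) x) ->
  (forall c, (forall b, \sum_i c i * 'd (F i) x (0, b) = 0) ->
    forall i, c i = 0) ->
  independent_at F x.
Proof.
move=> dF cF; apply: independent_atP => c c0; apply: cF => b.
have pairE : (0, b) = \sum_a b 0 a *: ((0, delta_mx 0 a) : TM R n).
  rewrite {1}[b]row_sum_delta.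
  apply: (big_rec2 (fun u (y : TM R n) => (0, u) = y)) => // a u _ _ <-.
  by congr pair; rewrite /= scaler0 addr0.
have ca a : \sum_i c i * 'd (F i) x (0, delta_mx 0 a) = 0.
  have /(congr1 (fun y : TM R n => y.2 0 a)) := c0.
  rewrite [RHS]mxE (big_morph (fun y : TM R n => y.2 0 a) (id1 := 0) (op1 := +%R)).
  - move=> E; rewrite -[RHS]E; apply: eq_bigr => i _; rewrite !mxE; congr (_ * _).
    by rewrite deriveE.
  - by move=> u v; rewrite mxE.
  - by rewrite mxE.
under eq_bigr => i _ do rewrite pairE linear_sum mulr_sumr.
rewrite exchange_big big1 // => a _.
under eq_bigr => i _ do rewrite linearZ mulrCA.
by rewrite -mulr_sumr ca mulr0.
Qed.

End Independence.

(** If the coordinate vanishes at a point of [O], moving by a small nonzero [t] in that coordinate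
    direction stays in [O] and makes the coordinate equal to [t]. *)
Lemma dense_snd_coord_neq0 (R : realType) n (i : 'I_n) :
  dense [set x : TM R n | x.2 0 i != 0].
Proof.
move=> O [x Ox] oO; have [x0|] := eqVneq (x.2 0 i) 0; last by exists x.
pose d : TM R n := (0, delta_mx 0 i).
have /(_ O) hx : (x + t *: d) @[t --> (0 : R)] --> x + 0 *: d.
  by apply: cvgD; [exact: cvg_cst|exact: scalel_continuous].
have /hx/nbhs_dnbhs Ot : nbhs (x + 0 *: d) O.
  by rewrite scale0r addr0; exact: open_nbhs_nbhs.
have [t [Oxt t0]] := filter_ex (filterI Ot (nbhs_dnbhs_neq (0 : R))).
by exists (x + t *: d); split=> //=; rewrite !mxE x0 add0r !eqxx mulr1.
Qed.

Lemma open_snd_coord_neq0 (R : realType) n (i : 'I_n) :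
  open [set x : TM R n | x.2 0 i != 0].
Proof.
apply: (@open_comp _ _ (fun x : TM R n => x.2 0 i) [set r | r != 0]).
  by move=> x _; exact: continuous_snd_coord.
exact: open_neq.
Qed.

(** * The star algebra and the left trivialization *)

Section StarAlgebra.
Context {R : realType} {k : nat}.
Implicit Types (X Y W : star_alg R k) (j : 'I_k) (c : R).

Definition iV0 : 'I_(star_dim k) := lshift k ord0.
Definition iV j : 'I_(star_dim k) := lshift k (lift ord0 j).
Definition iZ j : 'I_(star_dim k) := rshift k.+1 j.

Lemma star_ordP (P : 'I_(star_dim k) -> Prop) :
  P iV0 -> (forall j, P (iV j)) -> (forall j, P (iZ j)) -> forall i, P i.
Proof.
move=> P0 PV PZ i; case: (split_ordP i) => [a ->|j ->]; last exact: PZ.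
by case: (unliftP ord0 a) => [j ->|->]; [exact: PV|exact: P0].
Qed.

Lemma star_algP X Y : X 0 iV0 = Y 0 iV0 -> (forall j, X 0 (iV j) = Y 0 (iV j)) ->
  (forall j, X 0 (iZ j) = Y 0 (iZ j)) -> X = Y.
Proof. by move=> e0 eV eZ; apply/rowP; exact: star_ordP. Qed.

Lemma big_star (F : 'I_(star_dim k) -> R) :
  \sum_i F i = F iV0 + \sum_j F (iV j) + \sum_j F (iZ j).
Proof. by rewrite big_split_ord big_ord_recl. Qed.

Lemma dotE X Y : dot X Y = X 0 iV0 * Y 0 iV0 + \sum_j X 0 (iV j) * Y 0 (iV j)
  + \sum_j X 0 (iZ j) * Y 0 (iZ j).
Proof. exact: big_star. Qed.

Lemma dotC X Y : dot X Y = dot Y X.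
Proof. by apply: eq_bigr => i _; rewrite mulrC. Qed.

Lemma dotDl X Y W : dot (X + Y) W = dot X W + dot Y W.
Proof. by rewrite -big_split; apply: eq_bigr => i _; rewrite mxE mulrDl. Qed.

Lemma dotZl c X W : dot (c *: X) W = c * dot X W.
Proof. by rewrite mulr_sumr; apply: eq_bigr => i _; rewrite mxE mulrA. Qed.

Lemma dotNl X W : dot (- X) W = - dot X W.
Proof. by rewrite -scaleN1r dotZl mulN1r. Qed.

Lemma dotBl X Y W : dot (X - Y) W = dot X W - dot Y W.
Proof. by rewrite dotDl dotNl. Qed.

Lemma dot0l W : dot 0 W = 0.
Proof. by apply: big1 => i _; rewrite mxE mul0r. Qed.

Lemma dot_delta i W : dot (delta_mx 0 i) W = W 0 i.
Proof.
rewrite /dot (bigD1 i) //= big1 ?addr0 => [|m mi].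
  by rewrite mxE !eqxx mul1r.
by rewrite mxE (negbTE mi) andbF mul0r.
Qed.

Lemma dotV0 W : dot W (V0 R k) = W 0 iV0.
Proof. by rewrite dotC dot_delta. Qed.

Lemma dotVj j W : dot W (Vj R j) = W 0 (iV j).
Proof. by rewrite dotC dot_delta. Qed.

(** A product of equations, so that it serves as a single rewriting multi-rule. *)
Lemma Vj_coord j : (Vj R j 0 iV0 = 0) *
  (forall m, Vj R j 0 (iV m) = (m == j)%:R) * (forall m, Vj R j 0 (iZ m) = 0).
Proof.
by (split; first split) => [|m|m];
  rewrite mxE eqxx /= ?eq_rlshift ?(inj_eq (@lshift_inj _ _)) ?(inj_eq lift_inj).
Qed.

Lemma Zj_coord j : (basisZ R j 0 iV0 = 0) *
  (forall m, basisZ R j 0 (iV m) = 0) * (forall m, basisZ R j 0 (iZ m) = (m == j)%:R).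
Proof.
by (split; first split) => [|m|m];
  rewrite mxE eqxx /= ?eq_lrshift ?(inj_eq (@rshift_inj _ _)).
Qed.

Lemma V0_coord : (forall j, V0 R k 0 (iV j) = 0) * (forall j, V0 R k 0 (iZ j) = 0).
Proof.
by split=> j; rewrite mxE eqxx /= ?eq_rlshift ?(inj_eq (@lshift_inj _ _)).
Qed.

Lemma bracket_lshift X Y a : bracket X Y 0 (lshift k a) = 0.
Proof.
rewrite summxE big1 // => j _.
by rewrite /basisZ !mxE eqxx /= eq_lrshift mulr0.
Qed.

Lemma bracketV0 X Y : bracket X Y 0 iV0 = 0.
Proof. exact: bracket_lshift. Qed.

Lemma bracketV X Y j : bracket X Y 0 (iV j) = 0.
Proof. exact: bracket_lshift. Qed.

Lemma bracketZ X Y j : bracket X Y 0 (iZ j) =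
  X 0 iV0 * Y 0 (iV j) - Y 0 iV0 * X 0 (iV j).
Proof.
rewrite summxE (bigD1 j) //= big1 ?addr0 => [|m mj].
  by rewrite /basisZ !mxE !eqxx mulr1 !dotV0 !dotVj.
by rewrite /basisZ !mxE eqxx /= (inj_eq (@rshift_inj _ _)) eq_sym (negbTE mj) mulr0.
Qed.

Definition bracketE := (bracketV0, bracketV, bracketZ).

Lemma bracketvv Y : bracket Y Y = 0.
Proof. by apply: star_algP => [|m|m]; rewrite !bracketE ?mxE // subrr. Qed.

Lemma bracket0l Y : bracket 0 Y = 0.
Proof. by apply: star_algP => [|m|m]; rewrite !bracketE !mxE // mulr0 mul0r subr0. Qed.

Lemma bracketr0 Y : bracket Y 0 = 0.
Proof. by apply: star_algP => [|m|m]; rewrite !bracketE !mxE // mulr0 mul0r subr0. Qed.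

(** The bracket reads only V-coordinates, so Z_j is central. *)
Lemma bracketBZl X Y c j : bracket (X - c *: basisZ R j) Y = bracket X Y.
Proof.
by apply: star_algP => [|m|m]; rewrite !bracketE // !(Zj_coord, mxE) mulr0 !subr0.
Qed.

Lemma bracketBZr X Y c j : bracket Y (X - c *: basisZ R j) = bracket Y X.
Proof.
by apply: star_algP => [|m|m]; rewrite !bracketE // !(Zj_coord, mxE) mulr0 !subr0.
Qed.

Lemma bracket_Zl Y j : bracket (basisZ R j) Y = 0.
Proof.
by apply: star_algP => [|m|m]; rewrite !bracketE !(Zj_coord, mxE) // mulr0 mul0r subr0.
Qed.

Lemma bracket_Zr Y j : bracket Y (basisZ R j) = 0.
Proof.
by apply: star_algP => [|m|m]; rewrite !bracketE !(Zj_coord, mxE) // mulr0 mul0r subr0.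
Qed.

Lemma bracket_Vl Y j : bracket (Vj R j) Y = - (Y 0 iV0 *: basisZ R j).
Proof.
apply: star_algP => [|m|m]; rewrite !bracketE !(Zj_coord, Vj_coord, mxE) ?mulr0 ?oppr0 //.
by rewrite mul0r sub0r.
Qed.

Lemma bracket_Vr Y j : bracket Y (Vj R j) = Y 0 iV0 *: basisZ R j.
Proof.
apply: star_algP => [|m|m]; rewrite !bracketE !(Zj_coord, Vj_coord, mxE) ?mulr0 //.
by rewrite mul0r subr0 eq_sym.
Qed.

(** This is 2-step nilpotency: brackets have only Z-coordinates. *)
Lemma bracket_central X Y W c : bracket X (c *: bracket Y W) = 0.
Proof.
by apply: star_algP => [|m|m]; rewrite bracketE mxE // !mxE !bracketE !(mulr0, mul0r) subr0.
Qed.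

(* ad_Y^T Y *)
Definition coad Y : star_alg R k :=
  \sum_j Y 0 (iZ j) *: (Y 0 iV0 *: Vj R j - Y 0 (iV j) *: V0 R k).

(** The adjunction characterizing ad_Y^T, applied to Y. Only the Z-coordinates of the bracket
    survive, and the two sums agree term by term. *)
Lemma dot_coad Y W : dot (coad Y) W = dot Y (bracket Y W).
Proof.
rewrite (dotE Y) bracketV0 mulr0 add0r big1 => [|j _]; last first.
  by rewrite bracketV mulr0.
rewrite add0r /coad; elim/big_ind2: _ => [|a b c d <- <-|j _]; first exact: dot0l.
  exact: dotDl.
by rewrite dotZl dotBl !dotZl !(dotC _ W) dotV0 dotVj bracketZ; ring.
Qed.

End StarAlgebra.

(** The difference quotient is constantly [f v] for nonzero increments. *)
Lemma derive_affine (R : realType) (V W : normedModType R) (f : V -> W) (c : W)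
    (a v : V) :
  linear f -> 'D_v (fun x => f x + c) a = f v.
Proof.
move=> lf; apply: lim_near_cst; first exact: norm_hausdorff.
near=> h; have h0 : h != 0 by near: h; exact: nbhs_dnbhs_neq.
by rewrite /= lf opprD addrACA subrr addr0 addrK scalerA mulVf // scale1r.
Unshelve. all: by end_near. Qed.

(** * Left trivialization in the exponential chart, and derivatives of vector-valued maps *)

Section StarGroup.
Context {R : realType} {k : nat}.
Implicit Types (X Y W p v D : star_alg R k) (j : 'I_k).
Implicit Types (x A B : TM R (star_dim k)).

(* In the exponential chart, left translation by exp(-p) is affine; this is its
   linear part. *)
Definition left_velocity p v := v - 2^-1 *: bracket p v.

(** Since ad_p squares to 0, 1 + ad_p / 2 inverts 1 - ad_p / 2. It yields chart vectors with a
    prescribed left-invariant velocity. *)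
Definition left_velocity_inv p v := v + 2^-1 *: bracket p v.

Lemma left_velocity0 p v : left_velocity p v 0 iV0 = v 0 iV0.
Proof. by rewrite !mxE bracketE mulr0 subr0. Qed.

Lemma left_velocityV p v j : left_velocity p v 0 (iV j) = v 0 (iV j).
Proof. by rewrite !mxE bracketE mulr0 subr0. Qed.

Lemma left_velocityZ p v j : left_velocity p v 0 (iZ j) =
  v 0 (iZ j) - 2^-1 * (p 0 iV0 * v 0 (iV j) - v 0 iV0 * p 0 (iV j)).
Proof. by rewrite !mxE bracketE. Qed.

Definition left_velocityE := (left_velocity0, left_velocityV, left_velocityZ).

Lemma linear_left_velocity p : linear (left_velocity p).
Proof.
by move=> a u v; apply: star_algP => [|j|j]; rewrite !(left_velocityE, mxE) //; ring.
Qed.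

Lemma left_velocityK p : cancel (left_velocity_inv p) (left_velocity p).
Proof.
by move=> v; apply: star_algP => [|j|j]; rewrite !(left_velocityE, mxE, bracketE); ring.
Qed.

Lemma left_trivE x : left_triv x = (x.1, left_velocity x.1 x.2).
Proof.
case: x => p v; congr pair; rewrite /=.
(* In the chart, exp(-p) exp(W) is W - [p, W] / 2 - p, affine in W. *)
have -> : star_mul (star_inv p) = (fun W => left_velocity p W - p).
  apply/funext => W; apply: star_algP => [|j|j];
    by rewrite !(left_velocityE, mxE, bracketE) /star_inv ?mxE; ring.
exact/derive_affine/linear_left_velocity.
Qed.

(* [left_base] and [left_fibre] are the coordinates a and a' of A. *)
Definition left_base x A := left_velocity x.1 A.1.

Definition left_fibre x A :=
  A.2 - 2^-1 *: (bracket A.1 x.2 + bracket x.1 A.2).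

Lemma is_derive_fst_coord i x A : is_derive x A (fun y => y.1 0 i) (A.1 0 i).
Proof. by apply: linear_is_derive;
  [exact: linear_fst_coord|exact: continuous_fst_coord]. Qed.

Lemma is_derive_snd_coord i x A : is_derive x A (fun y => y.2 0 i) (A.2 0 i).
Proof. by apply: linear_is_derive;
  [exact: linear_snd_coord|exact: continuous_snd_coord]. Qed.

(** Differentiation is taken coordinatewise, so that the product rules for [bracket] and [dot] come
    from the scalar Leibniz rule. *)
Definition row_derive x A (F : TM R (star_dim k) -> star_alg R k)
    (D : star_alg R k) :=
  forall i, is_derive x A (fun y => F y 0 i) (D 0 i).

Lemma row_derive_fst x A : row_derive x A fst A.1.
Proof. by move=> i; exact: is_derive_fst_coord. Qed.

Lemma row_derive_snd x A : row_derive x A snd A.2.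
Proof. by move=> i; exact: is_derive_snd_coord. Qed.

Lemma row_derive_cst x A W : row_derive x A (fun=> W) 0.
Proof. by move=> i; rewrite mxE; exact: is_derive_cst. Qed.

Lemma row_deriveB x A F G D D' : row_derive x A F D -> row_derive x A G D' ->
  row_derive x A (fun y => F y - G y) (D - D').
Proof.
move=> FD GD i; rewrite !mxE.
under [X in is_derive _ _ X _]eq_fun do rewrite !mxE.
exact: is_deriveB.
Qed.

Lemma row_derive_scale x A (f : TM R (star_dim k) -> R) F (d : R) D :
  is_derive x A f d -> row_derive x A F D ->
  row_derive x A (fun y => f y *: F y) (f x *: D + d *: F x).
Proof.
move=> fd FD i; rewrite !mxE.
under [X in is_derive _ _ X _]eq_fun do rewrite mxE.
by rewrite [d * _]mulrC; exact: is_deriveM.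
Qed.

Lemma row_derive_bracket x A F G D D' :
  row_derive x A F D -> row_derive x A G D' ->
  row_derive x A (fun y => bracket (F y) (G y))
    (bracket D (G x) + bracket (F x) D').
Proof.
move=> FD GD; apply: star_ordP => [|j|j]; rewrite mxE !bracketE ?addr0.
- under [X in is_derive _ _ X _]eq_fun do rewrite bracketE.
  exact: is_derive_cst.
- under [X in is_derive _ _ X _]eq_fun do rewrite bracketE.
  exact: is_derive_cst.
- under [X in is_derive _ _ X _]eq_fun do rewrite bracketE.
  apply: is_derive_eq; first by apply: is_deriveB; exact: is_deriveM.
  by rewrite /GRing.scale /=; ring.
Qed.

Lemma is_derive_dot x A F G D D' : row_derive x A F D -> row_derive x A G D' ->
  is_derive x A (fun y => dot (F y) (G y)) (dot D (G x) + dot (F x) D').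
Proof.
move=> FD GD; rewrite /dot -big_split /=.
have -> : (fun y => \sum_i F y 0 i * G y 0 i) =
    (\sum_i (fun y => F y 0 i) * (fun y => G y 0 i))%R.
  by apply/funext => y; rewrite fct_sumE.
apply: (@is_derive_sum _ _ _ _ (fun i y => F y 0 i * G y 0 i)) => i.
rewrite addrC [D 0 i * _]mulrC.
exact: is_deriveM (FD i) (GD i).
Qed.

End StarGroup.

(** * Vector-valued maps with polynomial coordinates *)

Section Smoothness.
Context {R : realType} {V : normedModType R} {k : nat}.
Implicit Types (F G : V -> star_alg R k) (f : V -> R).

Definition polyrow F := forall i, polyfun (fun y => F y 0 i).

Lemma polyrow_cst (W : star_alg R k) : polyrow (fun=> W).
Proof. by move=> i; exact: polyfun_cst. Qed.

Lemma polyrowD F G : polyrow F -> polyrow G -> polyrow (fun y => F y + G y).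
Proof.
move=> pF pG i; under [X in polyfun X]eq_fun do rewrite mxE.
exact: polyfunD.
Qed.

Lemma polyrow_scale f F : polyfun f -> polyrow F ->
  polyrow (fun y => f y *: F y).
Proof.
move=> pf pF i; under [X in polyfun X]eq_fun do rewrite mxE.
exact: polyfunM.
Qed.

Lemma polyrowB F G : polyrow F -> polyrow G -> polyrow (fun y => F y - G y).
Proof.
move=> pF pG; under [X in polyrow X]eq_fun do rewrite -scaleN1r.
by apply: polyrowD => //; apply: polyrow_scale => //; exact: polyfun_cst.
Qed.

Lemma polyfun_dot F G : polyrow F -> polyrow G ->
  polyfun (fun y => dot (F y) (G y)).
Proof. by move=> pF pG; apply: polyfun_sum => i; exact: polyfunM. Qed.

Lemma polyrow_bracket F G : polyrow F -> polyrow G ->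
  polyrow (fun y => bracket (F y) (G y)).
Proof.
move=> pF pG i; under [X in polyfun X]eq_fun do rewrite summxE.
apply: polyfun_sum => j; apply: polyrow_scale; last exact: polyrow_cst.
under [X in polyfun X]eq_fun do rewrite -mulN1r.
apply: polyfunD; last apply: polyfunM; try exact: polyfun_cst;
  by apply: polyfunM; apply: polyfun_dot => //; exact: polyrow_cst.
Qed.

End Smoothness.

(** * The symplectic form in the left-invariant frame *)

Section StarGeometry.
Context {R : realType} {k : nat}.
Implicit Types (Y W p v D : star_alg R k) (j : 'I_k).
Implicit Types (x A B : TM R (star_dim k)).

Lemma polyrow_fst : polyrow (fun x => x.1).
Proof. by move=> i; apply: polyfun_lin;
  [exact: linear_fst_coord|exact: continuous_fst_coord]. Qed.

Lemma polyrow_snd : polyrow (fun x => x.2).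
Proof. by move=> i; apply: polyfun_lin;
  [exact: linear_snd_coord|exact: continuous_snd_coord]. Qed.

Lemma polyrow_left_velocity : polyrow (fun x => left_velocity x.1 x.2).
Proof.
apply: polyrowB; first exact: polyrow_snd.
apply: polyrow_scale; first exact: polyfun_cst.
by apply: polyrow_bracket; [exact: polyrow_fst|exact: polyrow_snd].
Qed.

(** With [F] the second projection the derivative is [left_fibre x A]; with [F] constant only the
    motion of the base point contributes. *)
Lemma row_derive_left_velocity x A F D : row_derive x A F D ->
  row_derive x A (fun y => left_velocity y.1 (F y))
    (D - 2^-1 *: (bracket A.1 (F x) + bracket x.1 D)).
Proof.
move=> FD; apply: row_deriveB => //.
have C : is_derive x A (fun=> 2^-1 : R) 0 by exact: is_derive_cst.
have := row_derive_scale C (row_derive_bracket (row_derive_fst x A) FD).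
by rewrite scale0r addr0.
Qed.

Lemma canonical_1formE x A : canonical_1form (@star_metric R k) x A =
  dot (left_velocity x.1 x.2) (left_velocity x.1 A.1).
Proof. by rewrite /canonical_1form /star_metric !left_trivE. Qed.

(** Leibniz rule for <Y, b>: Y varies by a', and b, for fixed [B.1], varies by -[A.1, B.1] / 2. *)
Lemma derive_canonical_1form x A B :
  'D_A (fun y : TM R (star_dim k) => canonical_1form (@star_metric R k) y B) x =
  dot (left_fibre x A) (left_base x B)
  - 2^-1 * dot (left_velocity x.1 x.2) (bracket A.1 B.1).
Proof.
rewrite (_ : (fun y => _) =
    fun y => dot (left_velocity y.1 y.2) (left_velocity y.1 B.1)); last first.
  by apply/funext => y; exact: canonical_1formE.
have C := row_derive_left_velocity (row_derive_cst x A B.1).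
rewrite (@derive_val _ _ _ _ _ _ _ (is_derive_dot
  (row_derive_left_velocity (row_derive_snd x A)) C)).
have -> : bracket x.1 0 = 0.
  by apply: star_algP => [|j|j]; rewrite !(mxE, bracketE) // mulr0 mul0r subr0.
by rewrite addr0 sub0r [X in _ + X]dotC dotNl dotZl [X in _ * X]dotC.
Qed.

(** By antisymmetry of the bracket the two half terms add up. Here [A.1, B.1] = [a, b], as
    [left_velocity] changes only central coordinates. *)
Lemma star_symplectic_formE x A B : symplectic_form (@star_metric R k) x A B =
  dot (left_fibre x B) (left_base x A) - dot (left_fibre x A) (left_base x B)
  + dot (left_velocity x.1 x.2) (bracket A.1 B.1).
Proof.
transitivity (- (dot (left_fibre x A) (left_base x B)
    - 2^-1 * dot (left_velocity x.1 x.2) (bracket A.1 B.1)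
  - (dot (left_fibre x B) (left_base x A)
    - 2^-1 * dot (left_velocity x.1 x.2) (bracket B.1 A.1)))).
  by congr (- (_ - _)); exact: derive_canonical_1form.
have -> : bracket B.1 A.1 = - bracket A.1 B.1.
  by apply: star_algP => [|j|j]; rewrite !(mxE, bracketE) ?oppr0 //; ring.
by rewrite [dot _ (- _)]dotC dotNl [dot (bracket _ _) _]dotC; field.
Qed.

End StarGeometry.

(** * The integrals of the geodesic flow *)

Section StarIntegrals.
Context {R : realType} {k : nat}.
Implicit Types (Y W p v D : star_alg R k) (j : 'I_k).
Implicit Types (x A B : TM R (star_dim k)).

Lemma fEE : @fE R k \o @left_triv R k =
  fun x => 2^-1 * dot (left_velocity x.1 x.2) (left_velocity x.1 x.2).
Proof. by apply/funext => x /=; rewrite left_trivE. Qed.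

Lemma fZE j : fZ j \o @left_triv R k =
  fun x => dot (basisZ R j) (left_velocity x.1 x.2).
Proof. by apply/funext => x /=; rewrite left_trivE. Qed.

Lemma fVE j : fV j \o @left_triv R k =
  fun x => dot (Vj R j - x.1 0 iV0 *: basisZ R j) (left_velocity x.1 x.2).
Proof. by apply/funext => x /=; rewrite left_trivE /fV /= dotV0. Qed.

Lemma polyfun_fE : polyfun (@fE R k \o @left_triv R k).
Proof.
rewrite fEE; apply: polyfunM; first exact: polyfun_cst.
by apply: polyfun_dot; exact: polyrow_left_velocity.
Qed.

Lemma polyfun_fZ j : polyfun (fZ j \o @left_triv R k).
Proof.
by rewrite fZE; apply: polyfun_dot; [exact: polyrow_cst|exact: polyrow_left_velocity].
Qed.

Lemma polyfun_fV j : polyfun (fV j \o @left_triv R k).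
Proof.
rewrite fVE; apply: polyfun_dot; last exact: polyrow_left_velocity.
apply: polyrowB; first exact: polyrow_cst.
by apply: polyrow_scale; [exact: polyrow_fst|exact: polyrow_cst].
Qed.

Lemma polyfun_diff (f : TM R (star_dim k) -> R) x B (d : R) :
  polyfun f -> is_derive x B f d -> 'd f x B = d.
Proof.
move=> pf [_ <-]; rewrite deriveE //; exact: polyfun_differentiable.
Qed.

(** The derivative of Y along [B], equal to [left_fibre x B] by unfolding. *)
Let dY x B := row_derive_left_velocity (row_derive_snd x B).

Lemma diff_fE x B : 'd (@fE R k \o @left_triv R k) x B =
  dot (left_velocity x.1 x.2) (left_fibre x B).
Proof.
apply: polyfun_diff; first exact: polyfun_fE.
rewrite fEE; have H := is_deriveZ 2^-1 (is_derive_dot (dY x B) (dY x B)).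
apply: (@is_derive_eq _ _ _ _ _ _ _ _ H).
by rewrite [X in _ *: (X + _)]dotC /GRing.scale /=; field.
Qed.

Lemma diff_fZ j x B : 'd (fZ j \o @left_triv R k) x B =
  dot (basisZ R j) (left_fibre x B).
Proof.
apply: polyfun_diff; first exact: polyfun_fZ.
rewrite fZE; have H := is_derive_dot (row_derive_cst x B (basisZ R j)) (dY x B).
by apply: (@is_derive_eq _ _ _ _ _ _ _ _ H); rewrite dot0l add0r.
Qed.

(** The last term comes from differentiating the coefficient p_0 of Z_j. *)
Lemma diff_fV j x B : 'd (fV j \o @left_triv R k) x B =
  dot (Vj R j - x.1 0 iV0 *: basisZ R j) (left_fibre x B)
  - B.1 0 iV0 * left_velocity x.1 x.2 0 (iZ j).
Proof.
apply: polyfun_diff; first exact: polyfun_fV.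
rewrite fVE; have S := row_derive_scale (row_derive_fst x B iV0)
  (row_derive_cst x B (basisZ R j)).
have H := is_derive_dot (row_deriveB (row_derive_cst x B (Vj R j)) S) (dY x B).
apply: (@is_derive_eq _ _ _ _ _ _ _ _ H).
rewrite scaler0 !add0r dotNl dotZl dot_delta addrC.
by [].
Qed.

End StarIntegrals.

(** * Hamiltonian fields, involution and independence of the integrals *)

Section StarFlow.
Context {R : realType} {k : nat}.
Implicit Types (i j : 'I_k) (x A B : TM R (star_dim k)).
Local Notation g := (@star_metric R k).

(** The geodesic field: p' = v, and Y' = ad_Y^T Y is the Euler equation, pulled back to the
    chart. *)
Definition ham_fE x : TM R (star_dim k) :=
  (x.2, left_velocity_inv x.1 (coad (left_velocity x.1 x.2))).

Definition ham_fZ j x : TM R (star_dim k) := (basisZ R j, 0).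

(** Passing to the frame subtracts a further p_0 / 2 times Z_j, hence the factor 1/2 in the base
    part. The fibre part is chosen to make a' vanish. *)
Definition ham_fV j x : TM R (star_dim k) :=
  (Vj R j - (2^-1 * x.1 0 iV0) *: basisZ R j, 2^-1 *: bracket (Vj R j) x.2).

Lemma left_base_fV j x :
  left_base x (ham_fV j x) = Vj R j - x.1 0 iV0 *: basisZ R j.
Proof.
rewrite /left_base /left_velocity bracketBZr bracket_Vr scalerA -addrA -opprD -scalerDl.
by congr (_ - _ *: _); field.
Qed.

Lemma left_base_fZ j x : left_base x (ham_fZ j x) = basisZ R j.
Proof. by rewrite /left_base /left_velocity bracket_Zr scaler0 subr0. Qed.

Lemma left_fibreE x A : left_fibre x A =
  left_velocity x.1 A.2 - 2^-1 *: bracket A.1 x.2.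
Proof. by rewrite /left_fibre scalerDr opprD addrAC addrA. Qed.

Lemma left_fibre_fE x :
  left_fibre x (ham_fE x) = coad (left_velocity x.1 x.2).
Proof.
by rewrite left_fibreE left_velocityK bracketvv scaler0 subr0.
Qed.

Lemma left_fibre_fZ j x : left_fibre x (ham_fZ j x) = 0.
Proof.
by rewrite left_fibreE /left_velocity bracket_Zl bracketr0 scaler0 !subr0.
Qed.

Lemma left_fibre_fV j x : left_fibre x (ham_fV j x) = 0.
Proof.
by rewrite left_fibreE /left_velocity bracketBZl bracket_central scaler0 subr0 subrr.
Qed.

Lemma bracket_velocity x A :
  bracket (left_velocity x.1 x.2) (left_velocity x.1 A.1) = bracket x.2 A.1.
Proof. by apply: star_algP => [|m|m]; rewrite !(bracketE, left_velocityE). Qed.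

(** The terms <ad_Y^T Y, b> and <Y, [Y, b]> cancel by adjunction, leaving <Y, b'>. *)
Lemma hamiltonian_fE x : hamiltonian_at g (@fE R k \o @left_triv R k) x (ham_fE x).
Proof.
move=> B; rewrite star_symplectic_formE diff_fE left_fibre_fE dot_coad bracket_velocity.
by rewrite subrK dotC.
Qed.

Lemma hamiltonian_fZ j x : hamiltonian_at g (fZ j \o @left_triv R k) x (ham_fZ j x).
Proof.
move=> B; rewrite star_symplectic_formE diff_fZ left_fibre_fZ left_base_fZ dot0l subr0.
by rewrite bracket_Zl [dot _ 0]dotC dot0l addr0 dotC.
Qed.

(** The bracket [V_j, B.1] is minus the V_0-coordinate of B.1 times Z_j, which reproduces the last
    term of the differential. *)
Lemma hamiltonian_fV j x : hamiltonian_at g (fV j \o @left_triv R k) x (ham_fV j x).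
Proof.
move=> B; rewrite star_symplectic_formE diff_fV left_fibre_fV left_base_fV dot0l subr0.
by rewrite bracketBZl bracket_Vl [dot _ (- _)]dotC dotNl dotZl dot_delta dotC.
Qed.

Lemma involution_fE_fE :
  in_involution g (@fE R k \o @left_triv R k) (@fE R k \o @left_triv R k).
Proof.
move=> x; rewrite (poissonE (hamiltonian_fE x) (hamiltonian_fE x)) diff_fE.
rewrite left_fibre_fE dotC dot_coad.
by rewrite bracketvv dotC dot0l.
Qed.

Lemma involution_fZ_fE j :
  in_involution g (fZ j \o @left_triv R k) (@fE R k \o @left_triv R k).
Proof.
move=> x; rewrite (poissonE (hamiltonian_fZ j x) (hamiltonian_fE x)) diff_fZ.
rewrite left_fibre_fE dotC dot_coad.
by rewrite bracket_Zr dotC dot0l.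
Qed.

Lemma involution_fZ_fZ i j :
  in_involution g (fZ i \o @left_triv R k) (fZ j \o @left_triv R k).
Proof.
move=> x; rewrite (poissonE (hamiltonian_fZ i x) (hamiltonian_fZ j x)) diff_fZ.
by rewrite left_fibre_fZ dotC dot0l.
Qed.

Lemma involution_fZ_fV i j :
  in_involution g (fZ i \o @left_triv R k) (fV j \o @left_triv R k).
Proof.
move=> x; rewrite (poissonE (hamiltonian_fZ i x) (hamiltonian_fV j x)) diff_fZ.
by rewrite left_fibre_fV dotC dot0l.
Qed.

(** The field of the second function has a' = 0 and no V_0-component in its base part, so both terms
    of the differential vanish on it. *)
Lemma involution_fV_fV i j :
  in_involution g (fV i \o @left_triv R k) (fV j \o @left_triv R k).
Proof.
move=> x; rewrite (poissonE (hamiltonian_fV i x) (hamiltonian_fV j x)) diff_fV.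
by rewrite left_fibre_fV dotC dot0l !(Zj_coord, Vj_coord, mxE) mulr0 subrr mul0r subr0.
Qed.

(** Pairing V_j - p_0 Z_j with ad_Y^T Y gives Y_0 <Y, Z_j>; the derivative of p_0 along the flow is
    v_0 = Y_0 and cancels it. *)
Lemma involution_fV_fE j :
  in_involution g (fV j \o @left_triv R k) (@fE R k \o @left_triv R k).
Proof.
move=> x; rewrite (poissonE (hamiltonian_fV j x) (hamiltonian_fE x)) diff_fV.
rewrite left_fibre_fE dotC dot_coad bracketBZr bracket_Vr left_velocity0.
by rewrite dotC dotZl dot_delta subrr.
Qed.

(** The letters cross in the indexing: slot [iV0] holds E, [iV j] holds f_{Z_j} and [iZ j] holds
    f_{V_j^*}. *)
Lemma star_family_E : @star_family R k iV0 = @fE R k \o @left_triv R k.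
Proof. by rewrite /star_family (unsplitK (inl _)) unlift_none. Qed.

Lemma star_family_Z j : @star_family R k (iV j) = fZ j \o @left_triv R k.
Proof. by rewrite /star_family (unsplitK (inl _)) liftK. Qed.

Lemma star_family_V j : @star_family R k (iZ j) = fV j \o @left_triv R k.
Proof. by rewrite /star_family (unsplitK (inr _)). Qed.

Lemma polyfun_star_family (i : 'I_(star_dim k)) : polyfun (@star_family R k i).
Proof.
move: i; apply: star_ordP => [|j|j]; rewrite (star_family_E, star_family_Z, star_family_V).
- exact: polyfun_fE.
- exact: polyfun_fZ.
- exact: polyfun_fV.
Qed.

Lemma involution_star_family (i j : 'I_(star_dim k)) :
  in_involution g (@star_family R k i) (@star_family R k j).
Proof.
move: i j; apply: star_ordP => [|i|i]; apply: star_ordP => [|j|j];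
  rewrite ?(star_family_E, star_family_Z, star_family_V).
- exact: involution_fE_fE.
- exact/in_involutionC/involution_fZ_fE.
- exact/in_involutionC/involution_fV_fE.
- exact: involution_fZ_fE.
- exact: involution_fZ_fZ.
- exact: involution_fZ_fV.
- exact: involution_fV_fE.
- exact/in_involutionC/involution_fZ_fV.
- exact: involution_fV_fV.
Qed.

(** Makes E a member of the family, so that being a first integral becomes a case of pairwise
    involution. *)
Lemma star_energyE : energy g = @fE R k \o @left_triv R k.
Proof. by rewrite fEE; apply/funext => x; rewrite /energy /star_metric !left_trivE. Qed.

Lemma independent_star_family x : x.2 0 iV0 != 0 ->
  independent_at (@star_family R k) x.
Proof.
move=> x0; apply: independent_at_fibre => [i|c c0].
  exact/polyfun_differentiable/polyfun_star_family.
(* The relation evaluated on the vertical vector along which Y has derivative [W]. *)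
have cW W : c iV0 * dot (left_velocity x.1 x.2) W + \sum_j c (iV j) * W 0 (iZ j)
    + \sum_j c (iZ j) * (W 0 (iV j) - x.1 0 iV0 * W 0 (iZ j)) = 0.
  rewrite -[RHS](c0 (left_velocity_inv x.1 W)) big_star.
  have fW : left_fibre x (0, left_velocity_inv x.1 W) = W.
    by rewrite left_fibreE left_velocityK bracket0l scaler0 subr0.
  congr (_ + _ + _); [|apply: eq_bigr => j _|apply: eq_bigr => j _]; congr (_ * _).
  - by rewrite star_family_E diff_fE fW.
  - by rewrite star_family_Z diff_fZ fW dot_delta.
  by rewrite star_family_V diff_fV fW dotBl dotZl !dot_delta mxE mul0r subr0.
(* Testing on V_0 leaves c_E Y_0, with Y_0 = v_0 nonzero. The tests on V_m and then Z_m each use the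
   coefficients already shown to vanish. *)
have cE : c iV0 = 0.
  have := cW (V0 R k); rewrite dotV0 left_velocity0 !big1.
  - by rewrite !addr0 => /eqP; rewrite mulf_eq0 (negbTE x0) orbF => /eqP.
  - by move=> j _; rewrite !V0_coord mulr0 subr0 mulr0.
  - by move=> j _; rewrite V0_coord mulr0.
have cV m : c (iZ m) = 0.
  have := cW (Vj R m); rewrite cE mul0r add0r big1 ?add0r => [|j _]; last first.
    by rewrite Vj_coord mulr0.
  rewrite (bigD1 m) //= big1 => [|j jm].
    by rewrite !Vj_coord eqxx mulr0 subr0 mulr1 addr0.
  by rewrite !Vj_coord (negbTE jm) mulr0 subr0 mulr0.
apply: star_ordP => // m.
have := cW (basisZ R m); rewrite cE mul0r add0r addrC big1 ?add0r => [|j _]; last first.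
  by rewrite cV mul0r.
rewrite (bigD1 m) //= big1 => [|j jm].
  by rewrite Zj_coord eqxx mulr1 addr0.
by rewrite Zj_coord (negbTE jm) mulr0.
Qed.

End StarFlow.

Theorem lemma4p1 (R : realType) (k : nat) (k_ge1 : (1 <= k)%N) :
  [/\ forall j : 'I_k, smooth (fV j \o @left_triv R k),
      forall i j : 'I_k,
        in_involution (@star_metric R k)
          (fV i \o @left_triv R k) (fV j \o @left_triv R k),
      completely_integrable (@star_metric R k)
    & liouville_system (@star_metric R k) (@star_family R k)].
Proof.
have S : liouville_system (@star_metric R k) (@star_family R k).
  split=> [i|i j|]; last 1 first.
  (* The open dense set is where v_0, hence Y_0, is nonzero. *)
  - exists [set x : TM R (star_dim k) | x.2 0 iV0 != 0]; split; first exact: open_snd_coord_neq0.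
      exact: dense_snd_coord_neq0.
    exact: independent_star_family.
  - split; first exact/polyfun_smooth/polyfun_star_family.
    by rewrite star_energyE -star_family_E; exact: involution_star_family.
  - exact: involution_star_family.
split=> // [j|i j|]; last by exists (@star_family R k).
- exact/polyfun_smooth/polyfun_fV.
- exact: involution_fV_fV.
Qed.
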